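(* Let $B_{end}$ be the set $B$ of labeled polynomials at the end of a terminating execution of the F5M algorithm on input $(f_1,\dots,f_m)\in (K[X])^m$ and an admissible order $\prec$ (the strategy for selecting critical pairs being arbitrary). Then the set $\{\mathrm{Poly}(\mathcal Q)\mid \mathcal Q\in B_{end}\}\subset K[X]$ is itself a Gröbner basis (with respect to $\prec$, of the ideal it generates).
   Context: **Basics.** $K$ is a field, $K[X]=K[x_1,\dots,x_n]$, $PP(X)$ is the set of power products $x^\alpha$, $\alpha\in\mathbb N^n$, and $\prec$ is an admissible (monomial) order on $PP(X)$. For $0\ne f\in K[X]$, $\mathrm{lpp}(f)$, $\mathrm{lc}(f)$, $\mathrm{lm}(f)=\mathrm{lc}(f)\mathrm{lpp}(f)$ are the leading power product, coefficient and monomial. Convention: $\mathrm{lpp}(0)=0$, which is strictly smaller than every power product (and than every signature) and divides no power product. ''Monomial'' means $cx^\gamma$ with $c\in K$, $c\neq0$. **Signatures.** Fix $(f_1,\dots,f_m)\in (K[X])^m$ (the initial polynomials). Let $\mathbf e_i$ be the $i$-th unit vector of $(K[X])^m$ and $\sigma(g_1,\dots,g_m)=g_1f_1+\cdots+g_mf_m$. Order the $x^\alpha\mathbf e_i$ by: $x^\alpha\mathbf e_i\prec x^\beta\mathbf e_j$ iff $i>j$, or $i=j$ and $x^\alpha\prec x^\beta$. $x^\alpha\mathbf e_i$ is a signature of $g$ if there is $\mathbf g\in(K[X])^m$ with $\sigma(\mathbf g)=g$ and $\mathrm{lpp}(\mathbf g)=x^\alpha\mathbf e_i$. **Labeled polynomials.**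 $L[X]$ is the set of triples $\mathcal G=(x^\alpha\mathbf e_i,g,k)$ with $x^\alpha\mathbf e_i$ a signature of $g\in\langle f_1,\dots,f_m\rangle$ and $k\in\mathbb N$. Write $\mathrm{Sign}(\mathcal G)=x^\alpha\mathbf e_i$, $\mathrm{Poly}(\mathcal G)=g$, $\mathrm{Num}(\mathcal G)=k$, $\mathrm{lpp}(\mathcal G)=\mathrm{lpp}(g)$, $\mathrm{lm}(\mathcal G)=\mathrm{lm}(g)$. For $p\in K[X]$, $p\mathcal G=(\mathrm{lpp}(p)x^\alpha\mathbf e_i,pg,k)$. Subtracting from $\mathcal F$ a labeled polynomial of strictly smaller signature subtracts the polynomial parts and keeps the signature and number of $\mathcal F$. Write $\mathcal F\lhd\mathcal G$ (or $\mathcal G\rhd\mathcal F$) iff $\mathrm{Sign}(\mathcal F)\prec\mathrm{Sign}(\mathcal G)$, or the signatures are equal and $\mathrm{Num}(\mathcal F)>\mathrm{Num}(\mathcal G)$; $\mathcal F\bowtie\mathcal G$ iff signatures and numbers are both equal. **Critical pairs.** For labeled polynomials $\mathcal F,\mathcal G$ with nonzero polynomial parts, the critical pair $[\mathcal F,\mathcal G]=(u,\mathcal F,v,\mathcal G)$ consists of monomials $u,v$ with $u\,\mathrm{lm}(\mathcal F)=v\,\mathrm{lm}(\mathcal G)=\mathrm{lcm}(\mathrm{lpp}(\mathcal F),\mathrm{lpp}(\mathcal G))$, the two entries being ordered so that $u\mathcal F\rhd v\mathcal G$. Its s-polynomial is $\mathrm{spoly}(\mathcal F,\mathcal G)=u\mathcal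 F-v\mathcal G=(\mathrm{Sign}(u\mathcal F),\,u\mathrm{Poly}(\mathcal F)-v\mathrm{Poly}(\mathcal G),\,\mathrm{Num}(\mathcal F))$. **Criteria.** Let $B\subset L[X]$, $\mathcal F=(x^\alpha\mathbf e_i,f,k_f)$ and $cx^\gamma$ a monomial. $cx^\gamma\mathcal F$ is *comparable* by $B$ if some $(x^\beta\mathbf e_j,g,k_g)\in B$ satisfies $\mathrm{lpp}(g)\mid x^{\gamma+\alpha}$ and $i<j$. It is *rewritable* by $B$ if some $(x^\beta\mathbf e_i,g,k_g)\in B$ satisfies $x^\beta\mid x^{\gamma+\alpha}$ and $k_f<k_g$. A critical pair $(u,\mathcal F,v,\mathcal G)$ meets the Syzygy (resp. Rewritten) Criterion w.r.t. $B$ if $u\mathcal F$ or $v\mathcal G$ is comparable (resp. rewritable) by $B$. **F5-reduction.** $\mathcal F$ is F5-reducible by $B$ if there is $\mathcal G\in B$ with (1) $\mathrm{lpp}(\mathcal G)\mid\mathrm{lpp}(\mathcal F)$; put $x^\gamma=\mathrm{lpp}(\mathcal F)/\mathrm{lpp}(\mathcal G)$, $c=\mathrm{lc}(\mathrm{Poly}(\mathcal F))/\mathrm{lc}(\mathrm{Poly}(\mathcal G))$; (2) $\mathrm{Sign}(\mathcal F)\succ\mathrm{Sign}(cx^\gamma\mathcal G)$; (3) $x^\gamma\mathcal G$ is not comparable by $B$; (4) $x^\gamma\mathcal G$ is not rewritable by $B$. One step replaces $\mathcal F$ by $\mathcal F-cx^\gamma\mathcal G$. $\mathcal F\Longrightarrow_B^*\mathcal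 F^*$ means $\mathcal F^*$ is obtained by repeating such steps until the result is not F5-reducible by $B$. **F5M algorithm.** Initialize $\mathcal F_i=(\mathbf e_i,f_i,i)$ for $1\le i\le m$, $k=m$, $B=\{\mathcal F_1,\dots,\mathcal F_m\}$, $D=\emptyset$, $CP=\{[\mathcal F_i,\mathcal F_j]\mid 1\le i<j\le m\}$. While $CP\ne\emptyset$: select (by any strategy) and remove some $cp$ from $CP$. If $cp$ meets neither criterion w.r.t. the current $B$: F5-reduce its s-polynomial by $B$ to some $\mathcal P$; set $\mathrm{Num}(\mathcal P)=k+1$; if $\mathrm{Poly}(\mathcal P)\ne0$, add to $CP$ all critical pairs $[\mathcal P,\mathcal Q]$, $\mathcal Q\in B$; set $k\leftarrow k+1$ and $B\leftarrow B\cup\{\mathcal P\}$ (whether or not $\mathrm{Poly}(\mathcal P)=0$). Otherwise $D\leftarrow D\cup\{cp\}$. (Critical pairs are only formed between labeled polynomials with nonzero polynomial parts.) *)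

(* Defs.v *)
From HB Require Import structures.
From Stdlib Require Import Relation_Operators.
From mathcomp Require Import all_boot all_order all_algebra.
From mathcomp Require Import finmap.
From mathcomp Require Import mpoly.

Set Implicit Arguments.
Unset Strict Implicit.
Unset Printing Implicit Defensive.

Import GRing.Theory.

Local Open Scope ring_scope.
Local Open Scope fset_scope.

(* Power products are the multinomials 'X_{1..n}: (a + b)%MM is the product of
   the power products a and b, (a <= b)%MM is divisibility, (b - a)%MM is the
   quotient (when a divides b) and 0%MM is the power product 1.  The library
   only provides leading monomials for one fixed order (degrevlex), hence the
   definitions below, which are relative to an arbitrary relation le. *)
Record admissible (n : nat) (le : rel 'X_{1..n}) : Prop := Admissible {
  adm_refl  : reflexive le;
  adm_anti  : antisymmetric le;
  adm_trans : transitive le;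
  adm_total : total le;
  adm_le0   : forall a, le 0%MM a;
  adm_add   : forall c a b, le a b -> le (a + c)%MM (b + c)%MM
}.

Section LeadingTerms.
Context (K : fieldType) (n : nat) (le : rel 'X_{1..n}).
Implicit Types (p : {mpoly K[n]}) (t : 'X_{1..n}).

Definition mlt : rel 'X_{1..n} := fun a b => (a != b) && le a b.

Definition mmax (a b : 'X_{1..n}) := if le a b then b else a.

(* lpp 0 is the junk value 0%MM, which stands for the power product 1.  Under
   the convention that the leading power product of 0 divides nothing,
   divisibility by the leading power product of p has to be lpp_dvd p. *)
Definition lpp p : 'X_{1..n} := \big[mmax/0%MM]_(t <- msupp p) t.

Definition lc p : K := p@_(lpp p).

Definition lpp_dvd p t : bool := (p != 0) && (lpp p <= t)%MM.

Definition in_ideal (S : {fset {mpoly K[n]}}) p : Prop :=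
  exists h : {mpoly K[n]} -> {mpoly K[n]}, p = \sum_(q <- S) h q * q.

Definition groebner_basis (S : {fset {mpoly K[n]}}) : Prop :=
  forall p, in_ideal S p -> p != 0 -> exists2 g, g \in S & lpp_dvd g (lpp p).

End LeadingTerms.

(* (a, i) stands for x^a e_i, where the unit vectors are indexed from 0. *)
Definition signature (n m : nat) : Type := ('X_{1..n} * 'I_m)%type.

(* Unconstrained triples: that lab_sign is a signature of lab_poly (is_labeled below) is
   an invariant of the algorithm, proved as F5M_labeled. *)
Record labeled (K : fieldType) (n m : nat) := Labeled {
  lab_sign : signature n m;
  lab_poly : {mpoly K[n]};
  lab_num  : nat
}.

Record critpair (K : fieldType) (n m : nat) := CritPair {
  cp_u : {mpoly K[n]};
  cp_F : labeled K n m;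
  cp_v : {mpoly K[n]};
  cp_G : labeled K n m
}.

Section ChoiceInstances.
Context (K : fieldType) (n m : nat).

Definition tuple_of_labeled (F : labeled K n m) := (lab_sign F, lab_poly F, lab_num F).
Definition labeled_of_tuple (t : signature n m * {mpoly K[n]} * nat) :=
  Labeled t.1.1 t.1.2 t.2.
Lemma tuple_of_labeledK : cancel tuple_of_labeled labeled_of_tuple.
Proof. by case. Qed.
HB.instance Definition _ := Choice.copy (labeled K n m) (can_type tuple_of_labeledK).

Definition tuple_of_critpair (c : critpair K n m) :=
  (cp_u c, cp_F c, cp_v c, cp_G c).
Definition critpair_of_tuple
    (t : {mpoly K[n]} * labeled K n m * {mpoly K[n]} * labeled K n m) :=
  CritPair t.1.1.1 t.1.1.2 t.1.2 t.2.
Lemma tuple_of_critpairK : cancel tuple_of_critpair critpair_of_tuple.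
Proof. by case. Qed.
HB.instance Definition _ := Choice.copy (critpair K n m) (can_type tuple_of_critpairK).

End ChoiceInstances.

Section F5M.
Context (K : fieldType) (n m : nat) (le : rel 'X_{1..n}).
Context (f : 'I_m -> {mpoly K[n]}).

Local Notation poly := {mpoly K[n]}.
Local Notation sig := (signature n m).
Local Notation lpol := (labeled K n m).
Local Notation cpair := (critpair K n m).
Local Notation lpp := (lpp le).
Local Notation lc := (lc le).

Implicit Types (s t : sig) (u v p : poly) (F G : lpol) (c : cpair).
Implicit Types (B : {fset lpol}).

Definition sig_lt s t : bool :=
  (t.2 < s.2)%N || ((s.2 == t.2) && mlt le s.1 t.1).

(* s is the leading term of the vector g of K[X]^m. *)
Definition is_vec_lpp (g : 'I_m -> poly) s : Prop :=
  s.1 \in msupp (g s.2) /\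
  forall t, t.1 \in msupp (g t.2) -> t = s \/ sig_lt t s.

Definition is_signature p s : Prop :=
  exists2 g : 'I_m -> poly, \sum_(i < m) g i * f i = p & is_vec_lpp g s.

Definition is_labeled F : Prop := is_signature (lab_poly F) (lab_sign F).

Definition sig_mul p s : sig := ((lpp p + s.1)%MM, s.2).

Definition lab_mul p F : lpol :=
  Labeled (sig_mul p (lab_sign F)) (p * lab_poly F) (lab_num F).

(* To be used only when lab_sign G is strictly smaller than lab_sign F, or when the
   signatures agree and lab_num F < lab_num G. *)
Definition lab_sub F G : lpol := Labeled (lab_sign F) (lab_poly F - lab_poly G) (lab_num F).

Definition lab_gt F G : bool :=
  sig_lt (lab_sign G) (lab_sign F) || ((lab_sign F == lab_sign G) && (lab_num F < lab_num G)%N).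

Definition cofactor_mon F G : poly :=
  (lc (lab_poly F))^-1 *: 'X_[(mlcm (lpp (lab_poly F)) (lpp (lab_poly G)) - lpp (lab_poly F))%MM].

Definition crit_pair F G : cpair :=
  let u := cofactor_mon F G in
  let v := cofactor_mon G F in
  if lab_gt (lab_mul u F) (lab_mul v G) then CritPair u F v G
  else CritPair v G u F.

Definition spoly c : lpol :=
  lab_sub (lab_mul (cp_u c) (cp_F c)) (lab_mul (cp_v c) (cp_G c)).

Definition F5_comparable B u F : Prop :=
  exists2 G, G \in B &
    lpp_dvd le (lab_poly G) (lpp u + (lab_sign F).1)%MM /\ ((lab_sign F).2 < (lab_sign G).2)%N.

Definition F5_rewritable B u F : Prop :=
  exists2 G, G \in B &
    [/\ (lab_sign G).2 = (lab_sign F).2,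
        ((lab_sign G).1 <= lpp u + (lab_sign F).1)%MM & (lab_num F < lab_num G)%N].

Definition meets_syzygy B c : Prop :=
  F5_comparable B (cp_u c) (cp_F c) \/ F5_comparable B (cp_v c) (cp_G c).

Definition meets_rewritten B c : Prop :=
  F5_rewritable B (cp_u c) (cp_F c) \/ F5_rewritable B (cp_v c) (cp_G c).

Definition red_mon F G : 'X_{1..n} := (lpp (lab_poly F) - lpp (lab_poly G))%MM.
Definition red_coef F G : K := lc (lab_poly F) / lc (lab_poly G).

Definition F5_reducer B F G : Prop :=
  [/\ (G \in B) && (lab_poly F != 0),
      lpp_dvd le (lab_poly G) (lpp (lab_poly F)),
      sig_lt (lab_sign (lab_mul (red_coef F G *: 'X_[red_mon F G]) G)) (lab_sign F),
      ~ F5_comparable B 'X_[red_mon F G] G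
    & ~ F5_rewritable B 'X_[red_mon F G] G].

Definition F5_reducible B F : Prop := exists G, F5_reducer B F G.

Definition F5_step B F F' : Prop :=
  exists2 G, F5_reducer B F G &
    F' = lab_sub F (lab_mul (red_coef F G *: 'X_[red_mon F G]) G).

Definition F5_reduces B F F' : Prop :=
  clos_refl_trans _ (F5_step B) F F' /\ ~ F5_reducible B F'.

Record F5M_state := F5MState {
  st_B  : {fset lpol};
  st_D  : {fset cpair};
  st_CP : {fset cpair};
  st_k  : nat
}.

Definition F5M_input (i : 'I_m) : lpol := Labeled (0%MM, i) (f i) i.+1.

Definition F5M_init : F5M_state :=
  F5MState [fset F5M_input i | i : 'I_m] fset0
    [fset crit_pair (F5M_input ij.1) (F5M_input ij.2) | ij : 'I_m * 'I_m
       & [&& (ij.1 < ij.2)%N, f ij.1 != 0 & f ij.2 != 0]]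
    m.

Definition renum F k : lpol := Labeled (lab_sign F) (lab_poly F) k.

Definition new_pairs B F : {fset cpair} :=
  [fset crit_pair F G | G in B & (lab_poly F != 0) && (lab_poly G != 0)].

Inductive F5M_step (S : F5M_state) : F5M_state -> Prop :=
| F5M_reduce c F : c \in st_CP S ->
    ~ meets_syzygy (st_B S) c -> ~ meets_rewritten (st_B S) c ->
    F5_reduces (st_B S) (spoly c) F ->
    let P := renum F (st_k S).+1 in
    F5M_step S (F5MState (P |` st_B S) (st_D S)
                  ((st_CP S `\ c) `|` new_pairs (st_B S) P) (st_k S).+1)
| F5M_discard c : c \in st_CP S ->
    meets_syzygy (st_B S) c \/ meets_rewritten (st_B S) c ->
    F5M_step S (F5MState (st_B S) (c |` st_D S) (st_CP S `\ c) (st_k S)).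

Definition F5M_reachable (S : F5M_state) : Prop :=
  clos_refl_trans _ F5M_step F5M_init S.

Definition F5M_output (B : {fset lpol}) : Prop :=
  exists S, [/\ F5M_reachable S, st_CP S = fset0 & st_B S = B].

Section Invariant.
Hypothesis adm : admissible le.

Lemma mmaxm0 a : mmax le a 0%MM = a.
Proof.
rewrite /mmax; case: ifP => // a0; apply/(adm_anti adm).
by rewrite a0 (adm_le0 adm).
Qed.

Lemma lpp_supp p : p != 0 -> lpp p \in msupp p.
Proof.
rewrite -msupp_eq0 /Defs.lpp; elim: (msupp p) => // a [|b s] IHs _.
  by rewrite big_cons big_nil mmaxm0 inE.
rewrite big_cons /mmax; case: ifP => _; last exact: mem_head.
by rewrite in_cons IHs ?orbT.
Qed.

Lemma lpp_max p a : a \in msupp p -> le a (lpp p).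
Proof.
rewrite /Defs.lpp; elim: (msupp p) => // b s IHs.
rewrite in_cons big_cons /mmax => /predU1P[->|/IHs le_a]; case: ifP => //.
  by rewrite (adm_refl adm).
move/negbT=> nle; apply: (adm_trans adm) le_a _.
by case/orP: (adm_total adm b (\big[mmax le/0%MM]_(t <- s) t)) nle => // ->.
Qed.

Lemma lppZX (a : K) g : a != 0 -> lpp (a *: 'X_[g]) = g.
Proof. by move=> a0; rewrite /Defs.lpp msuppMCX // big_cons big_nil mmaxm0. Qed.

Lemma lc_neq0 p : p != 0 -> lc p != 0.
Proof. by move/lpp_supp; rewrite mcoeff_msupp. Qed.

Lemma mlt_irr a : mlt le a a = false.
Proof. by rewrite /mlt eqxx. Qed.

Lemma mlt_trans : transitive (mlt le).
Proof.
move=> b a c /andP[ab lab] /andP[bc lbc]; apply/andP; split.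
  apply: contra ab => /eqP eac; apply/eqP/(adm_anti adm).
  by rewrite lab /= eac.
exact: (adm_trans adm) lab lbc.
Qed.

Lemma mlt_add a b g : mlt le a b -> mlt le (g + a)%MM (g + b)%MM.
Proof.
case/andP=> nab lab; rewrite /mlt ![(g + _)%MM]addmC (adm_add adm) // andbT.
by apply: contra nab => /eqP /addIm ->.
Qed.

Lemma sig_lt_irr s : sig_lt s s = false.
Proof. by rewrite /sig_lt ltnn eqxx mlt_irr. Qed.

Lemma sig_lt_trans : transitive sig_lt.
Proof.
move=> t s r /orP[h1|/andP[/eqP e1 h1]] /orP[h2|/andP[/eqP e2 h2]]; rewrite /sig_lt.
- by rewrite (ltn_trans h2 h1).
- by rewrite -e2 h1.
- by rewrite e1 h2.
- by rewrite e1 e2 eqxx (mlt_trans h1 h2) orbT.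
Qed.

Lemma sig_lt_total s t : s != t -> sig_lt s t || sig_lt t s.
Proof.
case: s t => [a i] [b j]; rewrite /sig_lt /= xpair_eqE.
have [||/val_inj->] := ltngtP i j; rewrite ?orbT // => nab.
move: nab; rewrite eqxx andbT /= => nab.
by rewrite /mlt (eq_sym b) nab /=; apply: adm_total.
Qed.

Lemma is_labeled_mul (a : K) g F :
  a != 0 -> is_labeled F -> is_labeled (lab_mul (a *: 'X_[g]) F).
Proof.
move=> a0 [h hE [hs hmax]].
have msuppE q : msupp (a *: 'X_[g] * q) =i [seq (g + b)%MM | b <- msupp q].
  move=> b; rewrite -scalerAl (perm_mem (msuppZ _ a0)) mulrC.
  exact: (perm_mem (msuppMX _ _)).
exists (fun i => a *: 'X_[g] * h i).
  by rewrite /= -hE mulr_sumr; apply: eq_bigr => i _; rewrite mulrA.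
rewrite /= /sig_mul lppZX //; split=> [|[b j]] /=.
  by rewrite msuppE map_f.
rewrite msuppE => /mapP[b' /(hmax (b', j)) hb ->].
case: hb => [<-|hb]; [by left | right].
move: hb; rewrite /sig_lt /=; case/orP=> [->//|/andP[-> /mlt_add->]].
by rewrite orbT.
Qed.

Lemma is_labeled_sub F G :
  sig_lt (lab_sign G) (lab_sign F) -> is_labeled F -> is_labeled G ->
  is_labeled (lab_sub F G).
Proof.
move=> ltGF [g gE [gs gmax]] [h hE [hs hmax]]; exists (fun i => g i - h i).
  by rewrite /= -gE -hE -sumrB; apply: eq_bigr => i _; rewrite mulrBl.
split=> /= [|t].
  rewrite mcoeff_msupp mcoeffB; move: (hmax (lab_sign F)).
  have [->|hnz] := eqVneq ((h (lab_sign F).2)@_(lab_sign F).1) 0.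
    by rewrite subr0 -mcoeff_msupp.
  rewrite mcoeff_msupp => /(_ hnz) [eFG|ltFG].
    by move: ltGF; rewrite eFG sig_lt_irr.
  by move: (sig_lt_trans ltGF ltFG); rewrite sig_lt_irr.
move/msuppB_le; rewrite mem_cat => /orP[/gmax//|/hmax[->|tG]]; right=> //.
exact: sig_lt_trans tG ltGF.
Qed.

Lemma F5_reduces_labeled B F F' :
  {in B, forall Q, is_labeled Q} -> is_labeled F -> F5_reduces B F F' ->
  is_labeled F'.
Proof.
move=> BL + [red _]; elim: red => // {F F'} [F F'|F1 F2 F3 _ IH1 _ IH2 /IH1/IH2//].
case=> G [/andP[GB F0] /andP[G0 _] ltGF _ _] -> FL.
apply: is_labeled_sub => //; apply: is_labeled_mul (BL _ GB).
by rewrite mulf_neq0 ?invr_eq0 ?lc_neq0.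
Qed.

Record F5M_invariant (S : F5M_state) : Prop := {
  inv_labeled : {in st_B S, forall Q, is_labeled Q};
  inv_num : {in st_B S, forall Q, (lab_num Q <= st_k S)%N};
  inv_inj : {in st_B S &, injective (@lab_num K n m)};
  inv_CP : {in st_CP S, forall c, exists F G,
    [/\ c = crit_pair F G, F \in st_B S, G \in st_B S, F != G
      & (lab_poly F != 0) && (lab_poly G != 0)]}
}.

Lemma F5M_init_invariant : F5M_invariant F5M_init.
Proof.
split=> /=.
- move=> _ /imfsetP[i _ ->] /=; exists (fun j => (j == i)%:R).
    rewrite /= (bigD1 i) //= eqxx mul1r big1 ?addr0 // => j /negPf->.
    by rewrite mul0r.
  split=> [|[a j]] /=; first by rewrite eqxx mcoeff_msupp mcoeff1 eqxx oner_eq0.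
  have [->|_] := eqVneq; last by rewrite msupp0.
  by rewrite msupp1 inE => /eqP->; left.
- by move=> _ /imfsetP[i _ ->] /=.
- move=> _ _ /imfsetP[i _ ->] /imfsetP[j _ ->] /= [].
  by move/val_inj->.
- move=> c /imfsetP[[i j] /= /and3P[ltij fi fj] ->].
  exists (F5M_input i), (F5M_input j); split=> //; rewrite ?in_imfset ?fi ?fj //.
  by apply/eqP=> -[] eij; move: ltij; rewrite eij ltnn.
Qed.

(* The two sides of a critical pair passing the criteria have distinct
   signatures, so the pair is correctly oriented. *)
Lemma crit_pairP S c : F5M_invariant S -> c \in st_CP S ->
  [/\ is_labeled (lab_mul (cp_u c) (cp_F c)),
      is_labeled (lab_mul (cp_v c) (cp_G c)),
      lab_gt (lab_mul (cp_u c) (cp_F c)) (lab_mul (cp_v c) (cp_G c))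
    & lab_sign (lab_mul (cp_u c) (cp_F c)) =
      lab_sign (lab_mul (cp_v c) (cp_G c)) -> meets_rewritten (st_B S) c].
Proof.
case=> BL _ Binj CPB /CPB[F [G [-> FB GB FG /andP[F0 G0]]]].
have Lu F1 G1 : lab_poly F1 != 0 -> is_labeled F1 ->
    is_labeled (lab_mul (cofactor_mon F1 G1) F1).
  by move=> F10; apply: is_labeled_mul; rewrite invr_eq0 lc_neq0.
have rw F1 G1 u v : G1 \in st_B S ->
    lab_gt (lab_mul u F1) (lab_mul v G1) ->
    lab_sign (lab_mul u F1) = lab_sign (lab_mul v G1) ->
    F5_rewritable (st_B S) u F1.
  move=> G1B + e; rewrite /lab_gt e sig_lt_irr eqxx /= => ltn.
  have e1 := congr1 fst e; have e2 := congr1 snd e; rewrite /= in e1 e2.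
  by exists G1 => //; split=> //; rewrite e1 lem_addl.
rewrite /crit_pair; case: ifP => [gt|/negbT ngt] /=.
  split=> // [||e]; [exact/Lu/BL | exact/Lu/BL | by left; apply: rw gt e].
have {}gt : lab_gt (lab_mul (cofactor_mon G F) G) (lab_mul (cofactor_mon F G) F).
  move: ngt; rewrite /lab_gt negb_or => /andP[/negPf nlt].
  have [-> /=|nst _] := eqVneq; last first.
    by move: (sig_lt_total nst); rewrite nlt orbF => ->.
  rewrite -leqNgt leq_eqVlt => /orP[/eqP e|->]; last by rewrite orbT.
  by move: FG; rewrite (Binj _ _ FB GB (esym e)) eqxx.
split=> // [||e]; [exact/Lu/BL | exact/Lu/BL | by left; apply: rw gt e].
Qed.

Lemma F5M_step_invariant S S' :
  F5M_invariant S -> F5M_step S S' -> F5M_invariant S'.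
Proof.
move=> SI; have [BL Bnum Binj CPB] := SI.
case=> [c F cCP nsyz nrew red P|c cCP _]; last first.
  by split=> //= d /fsetD1P[_]; exact: CPB.
have [uL vL gt eq_rew] := crit_pairP SI cCP.
have PL : is_labeled P.
  apply: F5_reduces_labeled BL _ red; apply: is_labeled_sub => //.
  by case/orP: gt => // /andP[/eqP/eq_rew].
have PB Q : Q \in st_B S -> lab_num Q != (st_k S).+1.
  by move/Bnum=> le_k; apply: contraL le_k => /eqP->; rewrite ltnn.
have inU Q : Q \in st_B S -> Q \in P |` st_B S by apply: fset1Ur.
split=> /=.
- by move=> Q /fset1UP[->//|]; exact: BL.
- by move=> Q /fset1UP[->//|/Bnum/leqW].
- move=> Q Q' /fset1UP[->|QB] /fset1UP[->|Q'B] //= e.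
  + by move: (PB _ Q'B); rewrite -e eqxx.
  + by move: (PB _ QB); rewrite e eqxx.
  + exact: Binj.
- move=> d /fsetUP[/fsetD1P[_ /CPB]|/imfsetP[Q /= /andP[QB PQ0] ->]].
    case=> [F1 [G1 [-> F1B G1B F1G1 F1G10]]].
    by exists F1, G1; split=> //; exact: inU.
  exists P, Q; split=> //; [exact: fset1U1 | exact: inU |].
  by apply: contra (PB _ QB) => /eqP <-.
Qed.

Theorem F5M_labeled S :
  F5M_reachable S -> {in st_B S, forall Q, is_labeled Q}.
Proof.
move=> reachS; apply: inv_labeled.
have: F5M_invariant F5M_init by exact: F5M_init_invariant.
elim: reachS => // [S1 S2 st /F5M_step_invariant|S1 S2 S3 _ IH1 _ IH2 /IH1/IH2//].
exact.
Qed.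

End Invariant.

End F5M.

(* Main.v *)
From Stdlib Require Import ClassicalEpsilon.
Require Import Defs.
From mathcomp Require Import all_boot all_order all_algebra.
From mathcomp Require Import finmap.
From mathcomp Require Import mpoly.

(* Call x^a Q normal if it is neither comparable nor rewritable by B_end.
   A critical pair u F - v G that is not discarded adds to B a labeled
   polynomial with the signature of u F and a larger number, so in the end one
   component of every critical pair is redundant: either it was discarded, or
   u F is rewritable by the new element.  Hence normal multiples of distinct
   elements never share their leading power product.  On the other hand, every
   signature is that of a syzygy (in the comparable case) or of a normal
   multiple, so by induction on signatures each element of the ideal is a
   combination of normal multiples with distinct signatures; no leading terms
   cancel in it.  Neither the result of the F5-reduction nor its irreducibility
   plays a role: only the signature and the number of the new element do. *)

Set Implicit Arguments.
Unset Strict Implicit.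
Unset Printing Implicit Defensive.

Import GRing.Theory.

Local Open Scope ring_scope.

(** * Dickson's lemma by extraction of monotone subsequences *)

Lemma tail_minimum (v : nat -> nat) N :
  exists x, (N <= x)%N /\ forall y, (N <= y)%N -> (v x <= v y)%N.
Proof.
suff H b : forall x, (N <= x)%N -> (v x <= b)%N ->
    exists x, (N <= x)%N /\ forall y, (N <= y)%N -> (v x <= v y)%N.
  exact: H (leqnn N) (leqnn _).
elim: b => [|b IHb] x Nx vx.
  by exists x; split=> // y _; move: vx; rewrite leqn0 => /eqP->.
have [[y [Ny vy]]|none] := classic (exists y, (N <= y)%N /\ (v y <= b)%N).
  exact: IHb vy.
exists x; split=> // y Ny; apply: leq_trans vx _; rewrite ltnNge.
by apply/negP => vy; apply: none; exists y.
Qed.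

(** [g N] is the position of a minimum of [v] on the tail from [N]. Restarting just after each such
    position gives minima over shrinking tails, which cannot decrease. *)
Lemma nondecreasing_subsequence (v : nat -> nat) :
  exists phi, {homo phi : i j / (i < j)%N} /\ {homo v \o phi : i j / (i <= j)%N}.
Proof.
pose g N := sval (constructive_indefinite_description _ (tail_minimum v N)).
have g_ge N : (N <= g N)%N.
  by rewrite /g; case: constructive_indefinite_description => x /= [].
have g_min N y : (N <= y)%N -> (v (g N) <= v y)%N.
  by rewrite /g; case: constructive_indefinite_description => x /= [_ minx] /minx.
pose c k := iter k (fun N => (g N).+1) 0%N.
have gS i : (g (c i) < g (c i.+1))%N by apply: g_ge.
exists (g \o c); split; first by apply: homo_ltn gS => y x z; exact: ltn_trans.
apply: homo_leq => [//|y x z|i /=]; first exact: leq_trans.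
exact/g_min/(leq_trans (g_ge _))/ltnW/gS.
Qed.

(** The subsequence is refined one coordinate at a time; [k] counts the coordinates already treated.
    With [k = n], earlier terms divide later ones. *)
Lemma dickson_subsequence n (u : nat -> 'X_{1..n}) k :
  exists phi, {homo phi : i j / (i < j)%N} /\
    forall x : 'I_n, (x < k)%N -> {homo (fun i => u (phi i) x) : i j / (i <= j)%N}.
Proof.
elim: k => [|k [phi [phi_mono phiP]]]; first by exists id; split.
have [ltkn|lenk] := ltnP k n; last first.
  by exists phi; split=> // x _; apply/phiP/(leq_trans (ltn_ord x)).
have [psi [psi_mono psiP]] :=
  nondecreasing_subsequence (fun i => u (phi i) (Ordinal ltkn)).
exists (phi \o psi); split=> [i j /psi_mono/phi_mono//|x].
rewrite ltnS leq_eqVlt => /predU1P[ex|ltx] i j leij.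
  by have -> : x = Ordinal ltkn; [exact: val_inj | exact: psiP].
apply: phiP => //; apply: (homo_leq leqnn (fun y x z => @leq_trans y x z)) leij => l.
exact/ltnW/psi_mono.
Qed.

(** * Well-foundedness of the orders on power products and signatures *)

Section AdmissibleOrder.
Context (n : nat) (le : rel 'X_{1..n}).
Hypothesis adm : admissible le.

Lemma adm_dvd a b : (a <= b)%MM -> le a b.
Proof.
move=> dvd_ab; have := adm_add adm a (adm_le0 adm (b - a)%MM).
by rewrite add0m submK.
Qed.

(** An infinite descending sequence would contain, by Dickson, a term dividing a later one, and
    divisibility implies [le]. *)
Lemma mlt_wf : well_founded (mlt le).
Proof.
move=> a0; apply: NNPP => nacc0; pose T := {a | ~ Acc (mlt le) a}.
have next (x : T) : exists y : T, mlt le (sval y) (sval x).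
  case: x => x nacc; apply: NNPP => none; apply: (nacc); constructor=> y lt_yx.
  by apply: NNPP => naccy; apply: none; exists (exist _ y naccy).
pose g x := sval (constructive_indefinite_description _ (next x)).
have g_lt x : mlt le (sval (g x)) (sval x).
  by rewrite /g; case: constructive_indefinite_description.
pose u i := sval (iter i g (exist _ a0 nacc0)).
have u_lt : {homo u : i j / (i < j)%N >-> mlt le j i}.
  by apply: homo_ltn => [y x z|i]; [move/[swap]; exact: mlt_trans | exact: g_lt].
have [phi [/(_ 0 1 isT)/u_lt/andP[neq lt10] phiP]] := dickson_subsequence u n.
have: le (u (phi 0)) (u (phi 1)).
  by apply/adm_dvd/mnm_lepP => x; apply: (phiP x).
by move=> lt01; case/negP: neq; apply/eqP/(adm_anti adm); rewrite lt10.
Qed.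

(** A larger index means a smaller signature, so the outer induction is on a bound for [m - s.2];
    within one index [mlt_wf] applies. *)
Lemma sig_lt_wf m : well_founded (@sig_lt n m le).
Proof.
suff H k : forall s : signature n m, (m - s.2 <= k)%N -> Acc (sig_lt le) s.
  by move=> s; apply: H (leqnn _).
elim: k => [|k IHk] [a i] /= le_k; first by rewrite leqNgt subn_gt0 ltn_ord in le_k.
elim/(well_founded_ind mlt_wf): a => a IHa; constructor=> -[b j].
case/orP=> /= [lt_ij|/andP[/eqP -> /IHa//]].
by apply: IHk => /=; rewrite -ltnS; apply: leq_trans le_k; apply: ltn_sub2l.
Qed.

End AdmissibleOrder.

(** * Leading power products of multiples and sums *)

Section LeadingTerms.
Context (K : fieldType) (n : nat) (le : rel 'X_{1..n}).
Hypothesis adm : admissible le.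
Implicit Types (p q : {mpoly K[n]}).

Lemma lppP p a : a \in msupp p -> (forall b, b \in msupp p -> le b a) -> lpp le p = a.
Proof.
move=> ap amax; have p0 : p != 0 by apply: contraTneq ap => ->; rewrite msupp0.
by apply/(adm_anti adm); rewrite amax ?lpp_supp // lpp_max.
Qed.

Lemma lpp_scale (a : K) p : a != 0 -> lpp le (a *: p) = lpp le p.
Proof.
move=> a0; have [->|p0] := eqVneq p 0; first by rewrite scaler0.
apply: lppP => [|b]; rewrite (perm_mem (msuppZ _ a0)); first exact: lpp_supp.
exact: lpp_max.
Qed.

Lemma lpp_mulX g p : p != 0 -> lpp le ('X_[g] * p) = (g + lpp le p)%MM.
Proof.
move=> p0; rewrite mulrC.
apply: lppP => [|b]; rewrite (perm_mem (msuppMX _ _)); first exact/map_f/lpp_supp.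
case/mapP=> c cp ->; rewrite ![(g + _)%MM]addmC.
exact/(adm_add adm)/lpp_max.
Qed.

Lemma lppD_lt p q : q != 0 -> mlt le (lpp le p) (lpp le q) ->
  lpp le (p + q) = lpp le q.
Proof.
move=> q0 /andP[neq lepq]; apply: lppP => [|b].
  have -> : lpp le q \in msupp (p + q) = (lpp le q \in msupp q).
    rewrite !mcoeff_msupp mcoeffD memN_msupp_eq0 ?add0r //.
    apply/negP => /(lpp_max adm) leqp; case/negP: neq.
    by apply/eqP/(adm_anti adm); rewrite lepq.
  exact: lpp_supp.
move/msuppD_le; rewrite mem_cat => /orP[/(lpp_max adm)|/(lpp_max adm)//].
by move=> leb; apply: (adm_trans adm) leb lepq.
Qed.

Lemma lppD p q : p != 0 -> q != 0 -> lpp le p != lpp le q ->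
  lpp le (p + q) = lpp le p \/ lpp le (p + q) = lpp le q.
Proof.
move=> p0 q0 neq; have [lepq|leqp] := orP (adm_total adm (lpp le p) (lpp le q)).
  by right; apply: lppD_lt => //; rewrite /mlt neq.
by left; rewrite addrC; apply: lppD_lt => //; rewrite /mlt eq_sym neq.
Qed.

End LeadingTerms.

(** * Leading terms of vectors, signatures and syzygies *)

Section F5M.
Context (K : fieldType) (n m : nat) (le : rel 'X_{1..n}) (f : 'I_m -> {mpoly K[n]}).
Hypothesis adm : admissible le.
Implicit Types (s t : signature n m) (F G P Q : labeled K n m).
Implicit Types (B : {fset labeled K n m}) (c : critpair K n m).
Implicit Types (g h w : 'I_m -> {mpoly K[n]}).

Lemma vec_lpp_exists g : (forall i, g i = 0) \/ exists s, is_vec_lpp le g s.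
Proof.
case: (pickP (fun i => g i != 0)) => [i0 gi0|g0]; last first.
  by left=> i; apply/eqP/negbFE/g0.
(* Smaller indices carry larger signatures, so the leading term lies in the first nonzero
   component. *)
right; case: (@arg_minnP _ i0 (fun i => g i != 0) (@nat_of_ord m) gi0) => i gi imin.
exists (lpp le (g i), i).
split=> [|[a j] /= aj]; first exact: lpp_supp.
have le_ij : (i <= j)%N by apply: imin; apply: contraTneq aj => ->; rewrite msupp0.
have [lt_ij|ge_ij] := ltnP i j; first by right; rewrite /sig_lt /= lt_ij.
have eij : i = j by apply/val_inj/anti_leq; rewrite le_ij ge_ij.
rewrite -{j le_ij ge_ij}eij in aj *.
have [->|nea] := eqVneq a (lpp le (g i)); first by left.
by right; rewrite /sig_lt /= eqxx /mlt nea (lpp_max adm aj) orbT.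
Qed.

(** The quotient of the leading coefficients cancels the common leading term. This is the descent
    step of the later induction on signatures. *)
Lemma vec_sub_lt g w s : is_vec_lpp le g s -> is_vec_lpp le w s ->
  exists2 a, a != 0 &
    forall t, t.1 \in msupp (g t.2 - a *: w t.2) -> sig_lt le t s.
Proof.
move=> [gs gmax] [ws wmax]; rewrite !mcoeff_msupp in gs ws.
exists ((g s.2)@_s.1 / (w s.2)@_s.1); first by rewrite mulf_neq0 ?invr_eq0.
move=> t tsupp; have [ets|] : t = s \/ sig_lt le t s; last by [].
  by move/msuppB_le: tsupp; rewrite mem_cat => /orP[/gmax//|/msuppZ_le/wmax].
by move: tsupp; rewrite ets mcoeff_msupp mcoeffB mcoeffZ divfK ?subrr ?eqxx.
Qed.

Lemma is_signature_mulX b q s : is_signature le f q s ->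
  is_signature le f ('X_[b] * q) (b + s.1, s.2)%MM.
Proof.
move=> qs; have := @is_labeled_mul K n m le f adm 1 b (Labeled s q 0) (oner_neq0 K) qs.
by rewrite /is_labeled /= /sig_mul lppZX ?oner_neq0 // scale1r.
Qed.

(* The Koszul syzygy  poly G * e_i - f_i * (vector of G). *)
Lemma comparable_signature0 B u F : {in B, forall Q, is_labeled le f Q} ->
  F5_comparable le B u F ->
  is_signature le f 0 (lpp le u + (lab_sign F).1, (lab_sign F).2)%MM.
Proof.
move=> BL [G /BL[h hE [_ hmax]] [/andP[G0 dvd] lt_FG]].
set a := (_ + _)%MM in dvd *; set i := (lab_sign F).2 in lt_FG *.
rewrite -(submK dvd) -[0](mulr0 'X_[a - lpp le (lab_poly G)]).
apply: (@is_signature_mulX _ 0 (lpp le (lab_poly G), i)).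
(* The signature of [G] has index above [i] and bounds all terms of [h]. Hence the leading term of
   the syzygy is that of [lab_poly G] in component [i]. *)
have h_gt t : t.1 \in msupp (h t.2) -> (i < t.2)%N.
  move=> /hmax[->//|]; case/orP=> [|/andP[/eqP-> _]] //.
  exact: ltn_trans.
have hi0 : h i = 0.
  apply/eqP; apply: contraT => hi; have := h_gt (lpp le (h i), i) (lpp_supp adm hi).
  by rewrite ltnn.
exists (fun j => (if j == i then lab_poly G else 0) - f i * h j).
  rewrite (eq_bigr (fun j => (if j == i then lab_poly G * f j else 0) - f i * (h j * f j))).
    by rewrite sumrB -big_mkcond big_pred1_eq -mulr_sumr hE mulrC subrr.
  by move=> j _; rewrite mulrBl mulrA; case: eqP => // _; rewrite mul0r.
split=> [|[b j]] /=; first by rewrite eqxx hi0 mulr0 subr0; exact: lpp_supp.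
have [-> {j}|neq] := eqVneq j i.
  rewrite hi0 mulr0 subr0 => bG.
  have [->|neb] := eqVneq b (lpp le (lab_poly G)); first by left.
  by right; rewrite /sig_lt /= eqxx /mlt neb (lpp_max adm bG) orbT.
rewrite sub0r => bj; right; apply/orP; left=> /=.
have hj : h j != 0.
  by apply: contraTneq bj => ->; rewrite mulr0 oppr0 msupp0.
exact: (h_gt (lpp le (h j), j)) (lpp_supp adm hj).
Qed.

(** * Invariant: every critical pair is pending or redundant *)

Definition redundant B u F := F5_comparable le B u F \/ F5_rewritable le B u F.

(** Stated with both cofactors, so that the orientation chosen by [crit_pair] does not matter. *)
Definition pair_redundant B F G :=
  redundant B (cofactor_mon le F G) F \/ redundant B (cofactor_mon le G F) G.

(** Serves twice: redundancy persists as [B] grows, and it passes from a cofactor to its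
    multiples. *)
Lemma redundant_mono B B' u v F : {subset B <= B'} -> (lpp le u <= lpp le v)%MM ->
  redundant B u F -> redundant B' v F.
Proof.
move=> sBB' le_uv; have le_uvF : (lpp le u + (lab_sign F).1 <= lpp le v + (lab_sign F).1)%MM.
  by apply/mnm_lepP => i; rewrite !mnmDE leq_add2r; apply/mnm_lepP.
case=> [[G /sBB' GB' [/andP[G0 dvd] ltG]]|[G /sBB' GB' [eG dvd ltG]]].
  by left; exists G => //; rewrite /lpp_dvd G0 (lepm_trans dvd le_uvF).
by right; exists G => //; split=> //; apply: lepm_trans dvd le_uvF.
Qed.

Lemma pair_redundantC B F G : pair_redundant B F G -> pair_redundant B G F.
Proof. by case; [right | left]. Qed.

Lemma crit_pair_redundant B F G :
  redundant B (cp_u (crit_pair le F G)) (cp_F (crit_pair le F G)) \/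
  redundant B (cp_v (crit_pair le F G)) (cp_G (crit_pair le F G)) ->
  pair_redundant B F G.
Proof. by rewrite /crit_pair; case: ifP => _ [] /=; by [left | right]. Qed.

Lemma meets_redundant B c : meets_syzygy le B c \/ meets_rewritten le B c ->
  redundant B (cp_u c) (cp_F c) \/ redundant B (cp_v c) (cp_G c).
Proof.
by case=> -[]; [left; left | right; left | left; right | right; right].
Qed.

(** By [handled_input], every signature is divisible by that of an element of [st_B S]. Both
    argument orders occur because the loop forms pairs with the newer element first. *)
Record pairs_handled (S : F5M_state K n m) : Prop := {
  handled_input : forall i, F5M_input f i \in st_B S;
  handled_pairs : {in st_B S &, forall F G, F != G ->
    lab_poly F != 0 -> lab_poly G != 0 ->
    crit_pair le F G \in st_CP S \/ crit_pair le G F \in st_CP S \/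
    pair_redundant (st_B S) F G}
}.

Lemma F5M_init_handled : pairs_handled (F5M_init le f).
Proof.
split=> /= [i|_ _ /imfsetP[i _ ->] /imfsetP[j _ ->] /=]; first exact: in_imfset.
have inCP (i0 j0 : 'I_m) : (i0 < j0)%N -> f i0 != 0 -> f j0 != 0 ->
    crit_pair le (F5M_input f i0) (F5M_input f j0) \in st_CP (F5M_init le f).
  by move=> ltij fi fj; apply/imfsetP; exists (i0, j0) => //=; rewrite inE /= ltij fi.
have [lt|lt|/val_inj->] := ltngtP i j; last by rewrite eqxx.
- by move=> _ fi fj; left; apply: inCP.
- by move=> _ fi fj; right; left; apply: inCP.
Qed.

Lemma F5_reduces_sign B F F' : F5_reduces le B F F' -> lab_sign F' = lab_sign F.
Proof.
by case=> red _; elim: red => // [{}F {}F' [G _ ->] //|F1 F2 F3 _ -> _ ->].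
Qed.

Lemma F5M_step_handled S S' :
  F5M_invariant le f S -> F5M_step le S S' -> pairs_handled S -> pairs_handled S'.
Proof.
move=> SI [c F cCP nsyz nrew red P|c cCP red] [inB SH]; last first.
  split=> //= F G FB GB FG F0 G0; have [FGc|GFc] := SH _ _ FB GB FG F0 G0.
    have [ec|nec] := eqVneq (crit_pair le F G) c.
      by right; right; apply/crit_pair_redundant; rewrite ec; apply: meets_redundant.
    by left; rewrite !inE nec.
  case: GFc => [GFc|]; last by right; right.
  have [ec|nec] := eqVneq (crit_pair le G F) c.
    right; right; apply/pair_redundantC/crit_pair_redundant.
    by rewrite ec; apply: meets_redundant.
  by right; left; rewrite !inE nec.
set B' := (P |` st_B S)%fset.
have sBB' : {subset st_B S <= B'} by move=> Q QB; apply: fset1Ur.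
have red_c : redundant B' (cp_u c) (cp_F c).
  right; exists P; first exact: fset1U1.
  rewrite /= (F5_reduces_sign red) /=; split=> //; first exact: lepm_refl.
  have [FB _] : cp_F c \in st_B S /\ cp_G c \in st_B S.
    have [F1 [G1 [-> F1B G1B _ _]]] := inv_CP SI cCP.
    by rewrite /crit_pair; case: ifP.
  (* Numbers in the old set are at most [st_k S]; [P] received the next one. *)
  by rewrite ltnS (inv_num SI).
have mono F1 G1 : pair_redundant (st_B S) F1 G1 -> pair_redundant B' F1 G1.
  by case=> r; [left | right]; apply: redundant_mono sBB' (lepm_refl _) r.
have new G1 : G1 \in st_B S -> lab_poly P != 0 -> lab_poly G1 != 0 ->
    crit_pair le P G1 \in new_pairs le (st_B S) P.
  by move=> G1B P0 G10; apply/imfsetP; exists G1 => //=; rewrite inE /= G1B P0.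
split=> /= [i|F1 G1 /fset1UP[->|F1B] /fset1UP[->|G1B]]; first exact: sBB'.
- by rewrite eqxx.
- by move=> _ P0 G10; left; rewrite in_fsetU new ?orbT.
- by move=> _ F10 P0; right; left; rewrite in_fsetU new ?orbT.
move=> FG F0 G0; have [FGc|[GFc|/mono]] := SH _ _ F1B G1B FG F0 G0; last by right; right.
  have [ec|nec] := eqVneq (crit_pair le F1 G1) c.
    by right; right; apply/crit_pair_redundant; rewrite ec; left.
  by left; rewrite !inE nec FGc.
have [ec|nec] := eqVneq (crit_pair le G1 F1) c.
  by right; right; apply/pair_redundantC/crit_pair_redundant; rewrite ec; left.
by right; left; rewrite !inE nec GFc.
Qed.

Lemma F5M_reachable_handled S : F5M_reachable le f S ->
  F5M_invariant le f S /\ pairs_handled S.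
Proof.
move=> reachS; move: (F5M_init_invariant le f) F5M_init_handled.
elim: reachS => {S} [S S' st SI SH|S _ //|S1 S2 S3 _ IH1 _ IH2 I1 /(IH1 I1)[]//].
by split; [exact: F5M_step_invariant st | exact: F5M_step_handled st SH].
Qed.

(** * Normal multiples in the final state *)

Section FinalState.
Context (S : F5M_state K n m).
Hypotheses (reachS : F5M_reachable le f S) (CP0 : st_CP S = fset0).
Local Notation B := (st_B S).

Let SI : F5M_invariant le f S. Proof. by case: (F5M_reachable_handled reachS). Qed.
Let SH : pairs_handled S. Proof. by case: (F5M_reachable_handled reachS). Qed.

Definition normal a Q := Q \in B /\ ~ redundant B 'X_[a] Q.

Definition normal_sign a Q : signature n m := (a + (lab_sign Q).1, (lab_sign Q).2)%MM.

Lemma lppX a : lpp le ('X_[a] : {mpoly K[n]}) = a.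
Proof. by rewrite -[X in lpp _ X]scale1r lppZX ?oner_neq0. Qed.

(** A common multiple of the two leading power products is divisible by their lcm, so [a] and [b]
    are multiples of the cofactors. With no pair pending, [F != G] would make one side redundant. *)
Lemma normal_lpp_inj a b F G : normal a F -> normal b G ->
  lab_poly F != 0 -> lab_poly G != 0 ->
  (a + lpp le (lab_poly F))%MM = (b + lpp le (lab_poly G))%MM -> a = b /\ F = G.
Proof.
move=> [FB nF] [GB nG] F0 G0 e.
have [eFG|neFG] := eqVneq F G; first by move: e; rewrite eFG => /addIm.
have cof_le (x y : 'X_{1..n}) F1 G1 : lab_poly F1 != 0 ->
    (x + lpp le (lab_poly F1))%MM = (y + lpp le (lab_poly G1))%MM ->
    (lpp le (cofactor_mon le F1 G1) <= lpp le ('X_[x] : {mpoly K[n]}))%MM.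
  move=> F10 exy; rewrite lppX lppZX // ?invr_eq0 ?lc_neq0 //.
  have : (mlcm (lpp le (lab_poly F1)) (lpp le (lab_poly G1)) <= x + lpp le (lab_poly F1))%MM.
    by rewrite lem_mlcm lem_addl exy lem_addl.
  move=> /mnm_lepP dvd; apply/mnm_lepP => i.
  by rewrite mnmBE leq_subLR addnC -mnmDE.
have [|[|[r|r]]] := handled_pairs SH FB GB neFG F0 G0; rewrite ?CP0 ?inE //.
- by case: nF; apply: redundant_mono r => //; exact: cof_le e.
- by case: nG; apply: redundant_mono r => //; exact: cof_le (esym e).
Qed.

(* When s is not comparable, the multiple of signature s of the element of
   largest number whose signature divides s is not rewritable. *)
Lemma signature_normal s : is_signature le f 0 s \/
  exists a Q, [/\ normal a Q, normal_sign a Q = s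
                & is_signature le f ('X_[a] * lab_poly Q) s].
Proof.
pose ok k := has (fun Q => [&& (lab_sign Q).2 == s.2, ((lab_sign Q).1 <= s.1)%MM
                              & lab_num Q == k]) B.
have ok_ex : exists k, ok k.
  (* The input of index [s.2] has signature 1 in that component; input numbers start at 1, indices
     at 0. *)
  exists s.2.+1; apply/hasP; exists (F5M_input f s.2).
    exact: handled_input.
  by rewrite /= !eqxx /= andbT; apply/mnm_lepP => i; rewrite mnm0E.
have ok_le k : ok k -> (k <= st_k S)%N.
  by case/hasP=> Q QB /and3P[_ _ /eqP<-]; exact: (inv_num SI QB).
case: (ex_maxnP ok_ex ok_le) => k /hasP[Q QB /and3P[/eqP e2 dvd /eqP eQ]] kmax.
pose a := (s.1 - (lab_sign Q).1)%MM.
have es : normal_sign a Q = s.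
  by rewrite /normal_sign submK // e2; case: (s).
have [cmp|ncmp] := classic (F5_comparable le B 'X_[a] Q).
  left; have := comparable_signature0 (inv_labeled SI) cmp.
  by rewrite lppX -/(normal_sign a Q) es.
right; exists a, Q; split=> //; last by rewrite -es; apply/is_signature_mulX/(inv_labeled SI).
split=> // -[//|[G GB [eG dvdG]]]; rewrite eQ ltnNge; case/negP; apply: kmax.
apply/hasP; exists G => //; rewrite lppX submK // in dvdG.
by rewrite eG e2 !eqxx dvdG.
Qed.

Definition led_by_normal (p : {mpoly K[n]}) s := exists a Q,
  [/\ normal a Q, lab_poly Q != 0, normal_sign a Q = s
    & lpp le p = (a + lpp le (lab_poly Q))%MM].

(** Used contrapositively: distinct signatures force distinct leading power products, which excludes
    cancellation. *)
Lemma led_by_normal_sign (p q : {mpoly K[n]}) s t : led_by_normal p s -> led_by_normal q t ->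
  lpp le p = lpp le q -> s = t.
Proof.
move=> [a [F [nF F0 <- ->]]] [b [G [nG G0 <- ->]]].
by move=> /(normal_lpp_inj nF nG F0 G0)[-> ->].
Qed.

(** Induction on [s]: subtract from [g] a multiple of a vector [w] with the same leading term whose
    image [q] is 0 or led at [s]. The rest is 0 or led strictly below [s], so the larger leading
    term survives in the sum. *)
Lemma sigma_led_by_normal s g : is_vec_lpp le g s -> \sum_i g i * f i != 0 ->
  exists2 t, led_by_normal (\sum_i g i * f i) t & t = s \/ sig_lt le t s.
Proof.
elim/(well_founded_ind (@sig_lt_wf _ _ adm m)): s g => s IH g gs sg0.
have [q [w wE ws] qP] : exists2 q, is_signature le f q s & q = 0 \/ led_by_normal q s.
  have [s0|[a [Q [nQ es sQ]]]] := signature_normal s; first by exists 0 => //; left.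
  exists ('X_[a] * lab_poly Q) => //.
  (* Elements of [B] with zero polynomial part record syzygies. *)
  have [Q0|Q0] := eqVneq (lab_poly Q) 0; first by left; rewrite Q0 mulr0.
  by right; exists a, Q; rewrite lpp_mulX.
have [x x0 rest_lt] := vec_sub_lt gs ws; pose r i := g i - x *: w i.
have eg : \sum_i g i * f i = x *: q + \sum_i r i * f i.
  rewrite -wE scaler_sumr -big_split; apply: eq_bigr => i _ /=.
  by rewrite mulrBl scalerAl addrC subrK.
have led_r : \sum_i r i * f i != 0 ->
    exists2 t, led_by_normal (\sum_i r i * f i) t & sig_lt le t s.
  move=> sr0; have [r0|[t rt]] := vec_lpp_exists r.
    by move: sr0; rewrite big1 ?eqxx // => i _; rewrite r0 mul0r.
  have lt_ts : sig_lt le t s by case: rt => [/rest_lt].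
  have [t' led le_t't] := IH t lt_ts r rt sr0; exists t' => //.
  by case: le_t't => [->|lt] //; exact: (sig_lt_trans adm) lt lt_ts.
have [q0|q0] := eqVneq q 0.
  move: eg; rewrite q0 scaler0 add0r => eg; rewrite eg in sg0 *.
  by have [t led lt] := led_r sg0; exists t => //; right.
case: qP => [/eqP|]; first by rewrite (negPf q0).
(* [led_by_normal] sees its polynomial only through [lpp], so it is invariant under nonzero
   scaling. *)
rewrite /led_by_normal -(lpp_scale adm q x0) -/(led_by_normal _ s) => led_q.
have [sr0|sr0] := eqVneq (\sum_i r i * f i) 0.
  by exists s; [rewrite eg sr0 addr0 | left].
have [t led_t lt_ts] := led_r sr0.
have neq : lpp le (x *: q) != lpp le (\sum_i r i * f i).
  apply: contraL lt_ts => /eqP/(led_by_normal_sign led_q led_t) <-.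
  by rewrite sig_lt_irr.
have xq0 : x *: q != 0 by rewrite scaler_eq0 negb_or x0.
rewrite eg /led_by_normal; have [->|->] := lppD adm xq0 sr0 neq.
  by exists s => //; left.
by exists t => //; right.
Qed.

End FinalState.

(** * From the ideal of the output to vectors over the input, and conclusion *)

Lemma labeled_ideal B p : {in B, forall Q, is_labeled le f Q} ->
  in_ideal [fset lab_poly Q | Q in B]%fset p -> exists g, \sum_i g i * f i = p.
Proof.
move=> BL [h ->].
rewrite big_seq; apply: (big_ind (fun p => exists g, \sum_i g i * f i = p)).
- by exists (fun=> 0); rewrite big1 // => i _; rewrite mul0r.
- move=> _ _ [g1 <-] [g2 <-]; exists (fun i => g1 i + g2 i).
  by rewrite -big_split; apply: eq_bigr => i _; rewrite mulrDl.
- move=> _ /imfsetP[Q /= /BL[g gE _] ->]; exists (fun i => h (lab_poly Q) * g i).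
  by rewrite -gE mulr_sumr; apply: eq_bigr => i _; rewrite mulrA.
Qed.

End F5M.

Theorem theorem4p3 (K : fieldType) (n m : nat) (le : rel 'X_{1..n})
    (le_adm : admissible le) (f : 'I_m -> {mpoly K[n]})
    (Bend : {fset labeled K n m}) (Bend_out : F5M_output le f Bend) :
  groebner_basis le [fset lab_poly Q | Q in Bend]%fset.
Proof.
case: Bend_out => S [reachS CP0 <-] p pS p0.
have [g gE] := labeled_ideal (F5M_labeled le_adm reachS) pS; rewrite -gE in p0 *.
have [g0|[s gs]] := vec_lpp_exists le_adm g.
  by move: p0; rewrite big1 ?eqxx // => i _; rewrite g0 mul0r.
have [t [a [Q [[QB _] Q0 _ ->]]] _] := sigma_led_by_normal le_adm reachS CP0 gs p0.
exists (lab_poly Q); first exact: in_imfset.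
by rewrite /lpp_dvd Q0 lem_addl.
Qed.
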